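(* In the setting of the context, suppose the regularity assumption and the local worst-case oracle assumption hold, and fix $x\in\mathcal X$ (write $\ell_k(z)=\ell_k(x,z)$), $i\in[N]$, $1\le k_1<k_2\le K$, $b\in\mathbb R_+$ and a weight $\alpha\in\mathbb R_+^2$ with $\alpha_1+\alpha_2=1$. Let $$\Psi_i^{(k_1,k_2)}(\alpha,\beta)=\max_{v_1,v_2}\Big\{\alpha_1\ell_{k_1}(\hat z_i+v_1)+\alpha_2\ell_{k_2}(\hat z_i+v_2): v_j\in\mathbb R^m,\ \hat z_i+v_j\in\mathcal Z,\ \alpha_jc(\hat z_i+v_j,\hat z_i)\le\beta_j,\ j\in\{1,2\}\Big\}.$$ Then for any two budget allocations $\beta,\beta'\in\mathbb R_+^2$ with $\beta_1+\beta_2=\beta_1'+\beta_2'=b$, $$\Big|\Psi_i^{(k_1,k_2)}(\alpha,\beta)-\Psi_i^{(k_1,k_2)}(\alpha,\beta')\Big|\le2G_i|\beta_1-\beta_1'|^{1/p},$$ where $G_i:=\max_{k\in[K]}\max\{\|\xi\|_*:\xi\in\partial\ell_k(\hat z_i)\}$.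
   Context: Notation: $[n]=\{1,\dots,n\}$; $\mathcal P(\mathcal Z)$ is the set of Borel probability measures on $\mathcal Z$; $\|\cdot\|_*$ is the dual norm of the norm $\|\cdot\|$ below; $\partial\ell_k(\hat z_i)$ is the superdifferential of the concave function $\ell_k$ at $\hat z_i$. Setting. $\mathcal X\subseteq\mathbb R^n$, $\mathcal Z\subseteq\mathbb R^m$. A transportation cost $c:\mathcal Z\times\mathcal Z\to\mathbb R_+$ is lower semicontinuous, satisfies $c(z,z)=0$ for all $z$, and $c(\cdot,\hat z)$ is convex for every fixed $\hat z\in\mathcal Z$. The optimal transport discrepancy is $\mathrm{OT}_c(\mathbb P,\mathbb Q)=\min_{\gamma}\mathbb E_{(z,\hat z)\sim\gamma}[c(z,\hat z)]$ over couplings $\gamma$ of $\mathbb P$ and $\mathbb Q$. Given $\hat z_1,\dots,\hat z_N\in\mathcal Z$, let $\hat{\mathbb P}=\frac1N\sum_{i=1}^N\delta_{\hat z_i}$; given $\rho>0$, let $\mathcal P=\{\mathbb P\in\mathcal P(\mathcal Z):\mathrm{OT}_c(\mathbb P,\hat{\mathbb P})\le\rho\}$. Regularity assumption. (i) $\mathcal X$ is nonempty and convex; there exist $\mathbb Q_0\in\mathcal P$ and $x_0\in\mathcal X$ such that $x\mapsto\mathbb E_{z\sim\mathbb Q_0}[\ell(x,z)]$ is inf-compact on $\mathcal X$ (all sublevel sets are compact) and $\mathbb E_{z\sim\mathbb Q_0}[\ell(x_0,z)]>-\infty$; $\mathcal Z$ is nonempty, closed and convex. (ii) $\ell(x,z)=\max_{k\in[K]}\ell_k(x,z)$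 with $K\ge2$, where each $\ell_k:\mathbb R^n\times\mathbb R^m\to\mathbb R$ is real-valued, convex in its first and concave in its second argument. (iii) There exist a norm $\|\cdot\|$ on $\mathbb R^m$ and $p\ge1$ with $c(z,\hat z)\ge\|z-\hat z\|^p$ for all $z,\hat z\in\mathcal Z$; moreover, if $p=1$, then for every $x\in\mathcal X$ there exist $g>0$, $\hat z_0\in\mathcal Z$ and $r\in[0,1)$ such that $\ell(x,z)\le g[1+\|z-\hat z_0\|^r]$ for all $z\in\mathcal Z$. Local worst-case oracle assumption. For any $k\in[K]$, $\hat z\in\mathcal Z$, radius $u\ge0$ and accuracy $\epsilon>0$ there is an algorithm that returns $\hat v\in\mathbb R^m$ with $\hat z+\hat v\in\mathcal Z$, $c(\hat z+\hat v,\hat z)\le u$, together with $\hat L=\ell_k(\hat z+\hat v)\ge\max\{\ell_k(\hat z+v):v\in\mathbb R^m,\hat z+v\in\mathcal Z,c(\hat z+v,\hat z)\le u\}-\epsilon$. *)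

(* Defs.v *)
(* MathComp-Analysis; vectors of R^m are row vectors 'rV[R]_m. *)
From HB Require Import structures.
From mathcomp Require Import all_boot all_order all_algebra.
From mathcomp Require Import all_classical all_reals all_analysis.

Set Implicit Arguments.
Unset Strict Implicit.
Unset Printing Implicit Defensive.

Import Order.TTheory GRing.Theory Num.Theory.
Import numFieldNormedType.Exports.

Local Open Scope classical_set_scope.
Local Open Scope ring_scope.

Definition is_max {R : realType} (S : set R) (M : R) : Prop :=
  S M /\ ubound S M.

Definition has_max {R : realType} (S : set R) : Prop := exists M, is_max S M.

(* The maximum of S; it is 0 by convention when S has no maximum, so its use
   should be accompanied by [has_max S]. *)
Definition maxval {R : realType} (S : set R) : R :=
  xget 0 [set M | is_max S M].

Definition concave_function {R : realType} {m : nat} (D : set 'rV[R]_m)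
  (f : 'rV[R]_m -> R) : Prop := convex_function D (fun z => - f z).

Record is_norm {R : realType} {m : nat} (nrm : 'rV[R]_m -> R) : Prop := IsNorm {
  is_norm_eq0 : forall v, nrm v = 0 -> v = 0;
  is_normZ : forall (a : R) v, nrm (a *: v) = `|a| * nrm v;
  is_normD : forall v w, nrm (v + w) <= nrm v + nrm w }.

Definition dot {R : realType} {m : nat} (xi v : 'rV[R]_m) : R :=
  \sum_(j < m) xi 0 j * v 0 j.

Definition dual_norm {R : realType} {m : nat} (nrm : 'rV[R]_m -> R)
  (xi : 'rV[R]_m) : R := sup [set dot xi v | v in [set v | nrm v <= 1]].

Definition superdifferential {R : realType} {m : nat} (f : 'rV[R]_m -> R)
  (z : 'rV[R]_m) : set 'rV[R]_m :=
  [set xi | forall y, f y <= f z + dot xi (y - z)].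

(* R^m with its Borel sigma-algebra *)
Definition borel (R : realType) (m : nat) :=
  g_sigma_algebraType (@open 'rV[R]_m).

(* Only the values of c on Z x Z are relevant. Lower semicontinuity is that of
   the restriction of c to Z x Z, through the subspace topology (in which the
   points outside Z x Z are isolated). *)
Record transport_cost {R : realType} {m : nat} (Z : set 'rV[R]_m)
  (c : 'rV[R]_m -> 'rV[R]_m -> R) : Prop := TransportCost {
  cost_ge0 : forall z zh, Z z -> Z zh -> 0 <= c z zh;
  cost_lsc : lower_semicontinuous
    (fun w : subspace (Z `*` Z) => (c w.1 w.2)%:E);
  cost_refl : forall z, Z z -> c z z = 0;
  cost_convex : forall zh, Z zh -> convex_function Z (c ^~ zh) }.

Definition is_coupling {R : realType} {m : nat}
  (mu nu : set (borel R m) -> \bar R)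
  (gamma : probability (borel R m * borel R m)%type R) : Prop :=
  forall A : set (borel R m), measurable A ->
    gamma (A `*` setT) = mu A /\ gamma (setT `*` A) = nu A.

(* The infimum over couplings, which is attained since the cost is nonnegative
   and lower semicontinuous; mu and nu are concentrated on Z, hence so is every
   coupling on Z x Z. *)
Definition OT {R : realType} {m : nat} (Z : set 'rV[R]_m)
  (c : 'rV[R]_m -> 'rV[R]_m -> R) (mu nu : set (borel R m) -> \bar R) : \bar R :=
  ereal_inf [set (\int[gamma]_(w in Z `*` Z) (c w.1 w.2)%:E)%E
            | gamma in [set gamma | is_coupling mu nu gamma]].

Definition empirical {R : realType} {m N : nat} (zhat : 'I_N -> 'rV[R]_m)
  (A : set (borel R m)) : \bar R :=
  ((N%:R^-1)%:E * \sum_(i < N) \d_(zhat i : borel R m) A)%E.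

(* Borel probability measures on the closed set Z are represented by those on
   R^m that give mass 1 to Z. *)
Definition ambiguity_set {R : realType} {m N : nat} (Z : set 'rV[R]_m)
  (c : 'rV[R]_m -> 'rV[R]_m -> R) (zhat : 'I_N -> 'rV[R]_m) (rho : R) :
  set (probability (borel R m) R) :=
  [set P | P Z = 1%E /\ (OT Z c P (empirical zhat) <= rho%:E)%E].

Definition loss {R : realType} {n m K : nat}
  (ellk : 'I_K -> 'rV[R]_n -> 'rV[R]_m -> R) (x : 'rV[R]_n) (z : 'rV[R]_m) : R :=
  maxval [set ellk k x z | k in setT].

Definition expected_loss {R : realType} {n m K : nat} (Z : set 'rV[R]_m)
  (ellk : 'I_K -> 'rV[R]_n -> 'rV[R]_m -> R) (P : probability (borel R m) R)
  (x : 'rV[R]_n) : \bar R := (\int[P]_(z in Z) (loss ellk x z)%:E)%E.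

Record regularity {R : realType} {n m K N : nat}
  (X : set 'rV[R]_n) (Z : set 'rV[R]_m) (c : 'rV[R]_m -> 'rV[R]_m -> R)
  (zhat : 'I_N -> 'rV[R]_m) (rho : R)
  (ellk : 'I_K -> 'rV[R]_n -> 'rV[R]_m -> R)
  (nrm : 'rV[R]_m -> R) (p : R) : Prop := Regularity {
  reg_X_nonempty : X !=set0;
  reg_X_convex : convex_set X;
  reg_inf_compact : exists Q0 x0,
    [/\ ambiguity_set Z c zhat rho Q0,
        X x0,
        forall t : R, compact [set x | X x /\ (expected_loss Z ellk Q0 x <= t%:E)%E]
      & (-oo < expected_loss Z ellk Q0 x0)%E];
  reg_Z_nonempty : Z !=set0;
  reg_Z_closed : closed Z;
  reg_Z_convex : convex_set Z;
  reg_K : (2 <= K)%N;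
  reg_convex : forall k z, convex_function setT (fun x => ellk k x z);
  reg_concave : forall k x, concave_function setT (ellk k x);
  reg_norm : is_norm nrm;
  reg_p : 1 <= p;
  reg_cost_growth : forall z zh, Z z -> Z zh -> nrm (z - zh) `^ p <= c z zh;
  reg_loss_growth : p = 1 -> forall x, X x -> exists (g : R) (zh0 : 'rV[R]_m) (r : R),
    [/\ 0 < g, Z zh0, 0 <= r < 1
      & forall z, Z z -> loss ellk x z <= g * (1 + nrm (z - zh0) `^ r)] }.

Definition cost_ball {R : realType} {m : nat} (Z : set 'rV[R]_m)
  (c : 'rV[R]_m -> 'rV[R]_m -> R) (zh : 'rV[R]_m) (u : R) : set 'rV[R]_m :=
  [set v | Z (zh + v) /\ c (zh + v) zh <= u].

(* f k is the k-th piece of the loss at the decision under consideration; the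
   oracle maps (k, zh, u, eps) to the pair (v, L). *)
Definition local_oracle {R : realType} {m K : nat} (Z : set 'rV[R]_m)
  (c : 'rV[R]_m -> 'rV[R]_m -> R) (f : 'I_K -> 'rV[R]_m -> R) : Prop :=
  exists oracle : 'I_K -> 'rV[R]_m -> R -> R -> 'rV[R]_m * R,
    forall k zh u eps, Z zh -> 0 <= u -> 0 < eps ->
      let: (v, L) := oracle k zh u eps in
      [/\ cost_ball Z c zh u v,
          L = f k (zh + v)
        & maxval [set f k (zh + w) | w in cost_ball Z c zh u] - eps <= L].

Definition Psi_values {R : realType} {m : nat} (Z : set 'rV[R]_m)
  (c : 'rV[R]_m -> 'rV[R]_m -> R) (f1 f2 : 'rV[R]_m -> R) (zh : 'rV[R]_m)
  (alpha beta : R * R) : set R :=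
  [set t | exists v1 v2,
    [/\ Z (zh + v1), Z (zh + v2),
        alpha.1 * c (zh + v1) zh <= beta.1,
        alpha.2 * c (zh + v2) zh <= beta.2
      & t = alpha.1 * f1 (zh + v1) + alpha.2 * f2 (zh + v2)]].

Definition Psi {R : realType} {m : nat} (Z : set 'rV[R]_m)
  (c : 'rV[R]_m -> 'rV[R]_m -> R) (f1 f2 : 'rV[R]_m -> R) (zh : 'rV[R]_m)
  (alpha beta : R * R) : R := maxval (Psi_values Z c f1 f2 zh alpha beta).

Definition supergradient_norms {R : realType} {m : nat} (nrm : 'rV[R]_m -> R)
  (f : 'rV[R]_m -> R) (z : 'rV[R]_m) : set R :=
  [set dual_norm nrm xi | xi in superdifferential f z].

Definition max_supergradient_norm {R : realType} {m K : nat}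
  (nrm : 'rV[R]_m -> R) (f : 'I_K -> 'rV[R]_m -> R) (z : 'rV[R]_m) : R :=
  maxval [set maxval (supergradient_norms nrm (f k) z) | k in setT].

(* Main.v *)
(* Scaling a displacement v, feasible for the budget u', by t = u / u' < 1 makes
   it feasible for the smaller budget u, because the cost is convex in its first
   argument and vanishes at zh. By concavity the objective drops by at most
   (1 - t)(f(zh + v) - f(zh)), where f(zh + v) - f(zh) <= G ||v|| for any bound
   G on the dual norms of the supergradients at zh, and ||v|| <= u'^(1/p) by the
   growth of the cost; finally (1 - t) u'^(1/p) <= (u' - u)^(1/p).
   The weights are harmless since a (u' / a)^(1/p) <= u'^(1/p) for 0 < a <= 1.
   Supergradients exist by a Hahn-Banach argument along the coordinates. They
   represent a concave function as an infimum of affine ones, which is also what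
   makes the maxima defining Psi attained. *)
Require Import Defs.
From HB Require Import structures.
From mathcomp Require Import all_boot all_order all_algebra.
From mathcomp Require Import all_classical all_reals all_analysis.
From mathcomp Require Import ring lra.

Set Implicit Arguments.
Unset Strict Implicit.
Unset Printing Implicit Defensive.

Import Order.TTheory GRing.Theory Num.Theory.
Import numFieldNormedType.Exports.

Local Open Scope classical_set_scope.
Local Open Scope ring_scope.

Section dot.
Context {R : realType} {m : nat}.
Implicit Types xi v w : 'rV[R]_m.

Lemma dotDl xi v w : dot (xi + v) w = dot xi w + dot v w.
Proof.
by rewrite /dot -big_split; apply: eq_bigr => j _; rewrite mxE mulrDl.
Qed.

Lemma dotDr xi v w : dot xi (v + w) = dot xi v + dot xi w.
Proof.
by rewrite /dot -big_split; apply: eq_bigr => j _; rewrite mxE mulrDr.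
Qed.

Lemma dotZl a xi v : dot (a *: xi) v = a * dot xi v.
Proof. by rewrite /dot mulr_sumr; apply: eq_bigr => j _; rewrite mxE mulrA. Qed.

Lemma dotZr a xi v : dot xi (a *: v) = a * dot xi v.
Proof. by rewrite /dot mulr_sumr; apply: eq_bigr => j _; rewrite mxE mulrCA. Qed.

Lemma dot0r xi : dot xi 0 = 0.
Proof. by rewrite -(scale0r 0) dotZr mul0r. Qed.

Lemma dotNr xi v : dot xi (- v) = - dot xi v.
Proof. by rewrite -scaleN1r dotZr mulN1r. Qed.

Lemma dot_delta xi j : dot xi (delta_mx 0 j) = xi 0 j.
Proof.
rewrite /dot (bigD1 j)//= big1 ?addr0; first by rewrite mxE !eqxx mulr1.
by move=> l /negbTE lj; rewrite mxE lj andbF mulr0.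
Qed.

Lemma delta_dot j v : dot (delta_mx 0 j) v = v 0 j.
Proof.
rewrite /dot (bigD1 j)//= big1 ?addr0; first by rewrite mxE !eqxx mul1r.
by move=> l /negbTE lj; rewrite mxE lj andbF mul0r.
Qed.

End dot.

Section convex_pointwise.
Context {R : realType} {m : nat}.
Implicit Types (D : set 'rV[R]_m) (f : 'rV[R]_m -> R).

Lemma convex_functionE D f : convex_function D f ->
  forall t y z, 0 <= t <= 1 -> D y -> D z ->
  f (t *: y + (1 - t) *: z) <= t * f y + (1 - t) * f z.
Proof.
move=> cf t y z /andP[t0 t1] Dy Dz.
exact: (cf (Itv01 t0 t1) y z (mem_set Dy) (mem_set Dz)).
Qed.

Lemma concave_functionE D f : concave_function D f ->
  forall t y z, 0 <= t <= 1 -> D y -> D z ->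
  t * f y + (1 - t) * f z <= f (t *: y + (1 - t) *: z).
Proof.
move=> /convex_functionE cf t y z t01 Dy Dz.
by have := cf _ _ _ t01 Dy Dz; rewrite !mulrN -opprD lerN2.
Qed.

Lemma convex_setE D : convex_set D ->
  forall t y z, 0 <= t <= 1 -> D y -> D z -> D (t *: y + (1 - t) *: z).
Proof.
move=> cD t y z /andP[t0 t1] Dy Dz; apply: set_mem.
exact: (cD y z (Itv01 t0 t1) (mem_set Dy) (mem_set Dz)).
Qed.

End convex_pointwise.

Section supergradient.
Context {R : realType} {m : nat}.

(* The slopes [a] admissible along [e] lie between the quotients in [A] and those
   of the forward increments, which convexity of [h] separates. *)
Lemma convex_minorant_step (h : 'rV[R]_m -> R) (V : set 'rV[R]_m)
    (e xi : 'rV[R]_m) :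
  (forall t y z, 0 <= t <= 1 ->
    h (t *: y + (1 - t) *: z) <= t * h y + (1 - t) * h z) ->
  V 0 ->
  (forall t y z, 0 <= t <= 1 -> V y -> V z -> V (t *: y + (1 - t) *: z)) ->
  (forall v, V v -> dot xi v <= h v) ->
  exists a, forall v r, V v -> dot xi v + r * a <= h (v + r *: e).
Proof.
move=> ch V0 cV xih.
pose A := [set (dot xi vs.1 - h (vs.1 - vs.2 *: e)) / vs.2
          | vs in [set vs : 'rV[R]_m * R | V vs.1 /\ 0 < vs.2]].
have key w t v s : V w -> 0 < t -> V v -> 0 < s ->
  (dot xi v - h (v - s *: e)) / s <= (h (w + t *: e) - dot xi w) / t.
  move=> Vw t0 Vv s0.
  have st0 : 0 < s + t by rewrite addr_gt0.
  pose l := t / (s + t).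
  have l1 : 1 - l = s / (s + t) by rewrite /l; field; rewrite gt_eqF.
  have l01 : 0 <= l <= 1.
    apply/andP; split; first by rewrite divr_ge0 // ltW.
    by rewrite ler_pdivrMr// mul1r lerDr ltW.
  have vE : l *: (v - s *: e) + (1 - l) *: (w + t *: e) = l *: v + (1 - l) *: w.
    rewrite !scalerDr scalerN !scalerA l1 addrACA.
    rewrite (_ : l * s = s / (s + t) * t); last by rewrite /l; ring.
    by rewrite addNr addr0.
  have := ch l (v - s *: e) (w + t *: e) l01; rewrite vE.
  move=> /(le_trans (xih _ (cV _ _ _ l01 Vv Vw))); rewrite dotDr !dotZr l1 /l.
  rewrite -(ler_pM2l st0) => H.
  rewrite ler_pdivrMr// mulrAC ler_pdivlMr//.
  rewrite [leLHS](_ : _ = t * dot xi v + s * dot xi w) in H; last first.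
    by field; rewrite gt_eqF.
  rewrite [leRHS](_ : _ = t * h (v - s *: e) + s * h (w + t *: e)) in H; last first.
    by field; rewrite gt_eqF.
  lra.
have A0 : A !=set0 by exists ((dot xi 0 - h (0 - 1 *: e)) / 1), (0, 1).
have ubA w t : V w -> 0 < t -> ubound A ((h (w + t *: e) - dot xi w) / t).
  by move=> Vw t0 _ [[v s] /= [Vv s0] <-]; exact: key.
exists (sup A) => v r Vv; have [r0|r0|->] := ltgtP r 0.
- have : (dot xi v - h (v - (- r) *: e)) / - r <= sup A.
    apply: ub_le_sup.
      by exists ((h (0 + 1 *: e) - dot xi 0) / 1); exact: ubA.
    by exists (v, - r) => //=; rewrite oppr_gt0.
  rewrite ler_pdivrMr ?oppr_gt0// scaleNr opprK; lra.
- have : sup A <= (h (v + r *: e) - dot xi v) / r.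
    by apply: ge_sup => //; exact: ubA.
  rewrite ler_pdivlMr//; lra.
- by rewrite mul0r scale0r !addr0; exact: xih.
Qed.

Lemma convex_minorant (h : 'rV[R]_m -> R) : h 0 = 0 ->
  (forall t y z, 0 <= t <= 1 ->
    h (t *: y + (1 - t) *: z) <= t * h y + (1 - t) * h z) ->
  exists xi, forall v, dot xi v <= h v.
Proof.
move=> h0 ch.
pose V k : set 'rV[R]_m := [set v | forall j : 'I_m, (k <= j)%N -> v 0 j = 0].
suff H k : (k <= m)%N -> exists xi, forall v, V k v -> dot xi v <= h v.
  have [xi xih] := H m (leqnn m).
  by exists xi => v; apply: xih => j; rewrite leqNgt ltn_ord.
elim: k => [_|k IHk km].
  exists 0 => v Vv; suff -> : v = 0 by rewrite dot0r h0.
  by apply/rowP => j; rewrite Vv// mxE.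
have [xi xih] := IHk (ltnW km).
pose j0 := Ordinal km.
have [||a xia] := @convex_minorant_step h (V k) (delta_mx 0 j0) xi ch _ _ xih.
- by move=> j _; rewrite mxE.
- by move=> t y z _ Vy Vz j kj; rewrite !mxE Vy// Vz// !mulr0 addr0.
exists (xi + (a - xi 0 j0) *: delta_mx 0 j0) => v Vv.
set w := v - v 0 j0 *: delta_mx 0 j0.
have Vw : V k w.
  move=> j kj; rewrite !mxE eqxx /=; have [->|jj0] := eqVneq j j0.
    by rewrite mulr1 subrr.
  rewrite mulr0 subr0 Vv// ltn_neqAle kj andbT; apply: contra jj0 => /eqP kj'.
  by apply/eqP/val_inj; rewrite /= kj'.
have := xia w (v 0 j0) Vw; rewrite subrK; apply: le_trans.
by rewrite dotDl dotZl delta_dot dotDr dotNr dotZr dot_delta; lra.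
Qed.

Lemma superdifferential_nonempty (f : 'rV[R]_m -> R) (z : 'rV[R]_m) :
  concave_function setT f -> superdifferential f z !=set0.
Proof.
move=> cf; have [||xi xih] := @convex_minorant (fun v => f z - f (z - v)).
- by rewrite subr0 subrr.
- move=> t v w t01.
  have := concave_functionE cf t01 (I : setT (z - v)) (I : setT (z - w)).
  rewrite (_ : _ *: _ + _ = z - (t *: v + (1 - t) *: w)); first lra.
  rewrite !scalerDr !scalerN addrACA -scalerDl [t + _]addrC subrK.
  by rewrite scale1r -opprD.
exists xi => y; have := xih (z - y); rewrite subKr -opprB dotNr; lra.
Qed.

End supergradient.

Lemma normr_coord {R : realType} {m : nat} (v : 'rV[R]_m) j : `|v 0 j| <= `|v|.
Proof.
rewrite [leRHS]/Num.norm /= mx_normrE.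
by apply/bigmax_geP; right; exists (0, j).
Qed.

Lemma normr_le_coord {R : realType} {m : nat} (v : 'rV[R]_m) (M : R) :
  0 <= M -> (forall j, `|v 0 j| <= M) -> `|v| <= M.
Proof.
move=> M0 vM; rewrite [leLHS]/Num.norm /= mx_normrE.
by apply/bigmax_leP; split => // -[i j] _ /=; rewrite ord1.
Qed.

Lemma normr_bounded_set {R : realType} {m : nat} (A : set 'rV[R]_m) (M : R) :
  (forall v, A v -> `|v| <= M) -> bounded_set A.
Proof.
move=> AM; exists M; split; first exact: num_real.
by move=> x Mx v /AM vM; exact: le_trans vM (ltW Mx).
Qed.

Lemma dot_continuous {R : realType} {m : nat} :
  continuous (fun w : 'rV[R]_m * 'rV[R]_m => dot w.1 w.2).
Proof.
apply: continuous_big => [|j _].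
  exact: add_continuous.
move=> w; apply: cvgM.
- apply: (@continuous_comp _ _ _ fst (fun M : 'rV[R]_m => M 0 j)).
    exact: cvg_fst.
  exact: coord_continuous.
- apply: (@continuous_comp _ _ _ snd (fun M : 'rV[R]_m => M 0 j)).
    exact: cvg_snd.
  exact: coord_continuous.
Qed.

Lemma dot_continuousr {R : realType} {m : nat} (xi : 'rV[R]_m) :
  continuous (dot xi).
Proof.
apply: continuous_big => [|j _ v]; first exact: add_continuous.
apply: (@continuous_comp _ _ _ (fun M : 'rV[R]_m => M 0 j) ( *%R (xi 0 j))).
  exact: coord_continuous.
exact: mulrl_continuous.
Qed.

Section norm_facts.
Context {R : realType} {m : nat} (nrm : 'rV[R]_m -> R).
Hypothesis hn : is_norm nrm.

Lemma is_norm0 : nrm 0 = 0.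
Proof. by rewrite -(scale0r 0) (is_normZ hn) normr0 mul0r. Qed.

Lemma is_normN v : nrm (- v) = nrm v.
Proof. by rewrite -scaleN1r (is_normZ hn) normrN1 mul1r. Qed.

Lemma is_norm_ge0 v : 0 <= nrm v.
Proof. by have := is_normD hn v (- v); rewrite subrr is_norm0 is_normN; lra. Qed.

Lemma is_norm_le_normr : exists2 C, 0 <= C & forall v, nrm v <= C * `|v|.
Proof.
exists (\sum_(j < m) nrm (delta_mx 0 j)).
  by apply: sumr_ge0 => j _; exact: is_norm_ge0.
move=> v; rewrite {1}[v]row_sum_delta mulr_suml.
apply: (@le_trans _ _ (\sum_(j < m) nrm (v 0 j *: delta_mx 0 j))).
  elim/big_ind2 : _ => //; first by rewrite is_norm0.
  by move=> a x c y ax cy; exact: le_trans (is_normD hn _ _) (lerD ax cy).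
apply: ler_sum => j _; rewrite (is_normZ hn) mulrC.
by apply: ler_wpM2l; [exact: is_norm_ge0|exact: normr_coord].
Qed.

Lemma is_norm_continuous : continuous nrm.
Proof.
have [C C0 nC] := is_norm_le_normr.
have dist v w : `|nrm v - nrm w| <= C * `|v - w|.
  rewrite ler_norml; apply/andP; split.
    have := is_normD hn v (- (v - w)); have := nC (v - w).
    by rewrite subKr is_normN; lra.
  have := is_normD hn w (v - w); have := nC (v - w).
  by rewrite [w + _]addrC subrK; lra.
move=> v; have FF := nbhs_filter v; apply/cvgrPdist_le => e e0.
have d0 : 0 < e / (C + 1) by rewrite divr_gt0// ltr_wpDl.
near=> w; apply: le_trans (dist _ _) _.
apply: (@le_trans _ _ (C * (e / (C + 1)))).
  by apply: ler_wpM2l => //; near: w; exact: cvgr_dist_le.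
by rewrite mulrCA ger_pMr// ler_pdivrMr ?ltr_wpDl// mul1r lerDl.
Unshelve. all: by end_near. Qed.

Lemma normr_le_is_norm : exists2 C, 0 < C & forall v, `|v| <= C * nrm v.
Proof.
pose S := [set v : 'rV[R]_m | `|v| = 1].
have [S0|] := pselect (S !=set0); last first.
  move=> S0; exists 1 => // v; have [->|v0] := eqVneq v 0.
    by rewrite normr0 is_norm0 mulr0.
  exfalso; apply: S0; exists (`|v|^-1 *: v) => /=.
  by rewrite /S/= normrZ normfV normr_id mulVf// normr_eq0.
have cS : compact S.
  apply: bounded_closed_compact.
    by apply: (@normr_bounded_set _ _ _ 1) => v ->.
  rewrite (_ : S = Num.norm @^-1` [set 1 : R])//.
  by apply: preimage_closed => [v _|]; [exact: norm_continuous|exact: closed_eq].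
have [v /set_mem v1 vmin] := EVT_min_rV S0 cS
  (continuous_subspaceT is_norm_continuous).
have nv0 : 0 < nrm v.
  rewrite lt_neqAle is_norm_ge0 andbT eq_sym; apply/eqP => /(is_norm_eq0 hn) v0.
  by move: v1; rewrite v0 /S/= normr0 => /eqP; rewrite eq_sym oner_eq0.
exists (nrm v)^-1; first by rewrite invr_gt0.
move=> w; have [->|w0] := eqVneq w 0; first by rewrite normr0 is_norm0 mulr0.
have nw0 : 0 < `|w| by rewrite normr_gt0.
have : nrm v <= nrm (`|w|^-1 *: w).
  by apply: vmin; rewrite inE /S/= normrZ normfV normr_id mulVf// gt_eqF.
rewrite (is_normZ hn) normfV normr_id => H.
by rewrite mulrC ler_pdivlMr// mulrC -ler_pdivlMr// mulrC.
Qed.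

Lemma is_norm_ball_compact : compact [set v | nrm v <= 1].
Proof.
apply: bounded_closed_compact.
  have [C C0 nC] := normr_le_is_norm.
  apply: (@normr_bounded_set _ _ _ C) => v /= v1; apply: le_trans (nC v) _.
  by rewrite -[leRHS]mulr1 ler_pM2l.
rewrite (_ : [set _ | _] = nrm @^-1` [set x | x <= 1])//.
by apply: preimage_closed => [v _|]; [exact: is_norm_continuous|exact: closed_le].
Qed.

Lemma dual_norm_attained xi :
  exists2 v, nrm v <= 1 & dual_norm nrm xi = dot xi v /\
    forall w, nrm w <= 1 -> dot xi w <= dot xi v.
Proof.
have B0 : [set v | nrm v <= 1] !=set0 by exists 0; rewrite /= is_norm0.
have [v /set_mem v1 vmax] := EVT_max_rV B0 is_norm_ball_compact
  (continuous_subspaceT (@dot_continuousr _ _ xi)).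
have {}vmax w : nrm w <= 1 -> dot xi w <= dot xi v.
  by move=> w1; apply: vmax; rewrite inE.
exists v => //; split => //; apply/le_anti/andP; split.
  apply: ge_sup; first by exists (dot xi v), v.
  by move=> _ [w w1 <-]; exact: vmax.
apply: ub_le_sup; last by exists v.
by exists (dot xi v) => _ [w w1 <-]; exact: vmax.
Qed.

Lemma dual_norm_ge0 xi : 0 <= dual_norm nrm xi.
Proof.
have [v _ [-> /(_ 0)]] := dual_norm_attained xi.
by rewrite dot0r is_norm0; apply.
Qed.

Lemma dot_le_dual_norm xi v : dot xi v <= dual_norm nrm xi * nrm v.
Proof.
have [w _ [-> wmax]] := dual_norm_attained xi.
have [->|v0] := eqVneq v 0; first by rewrite dot0r is_norm0 mulr0.
have nv0 : 0 < nrm v.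
  rewrite lt_neqAle is_norm_ge0 andbT eq_sym.
  by apply: contra_neq v0; exact: is_norm_eq0.
rewrite -ler_pdivrMr// mulrC -dotZr; apply: wmax.
by rewrite (is_normZ hn) normfV ger0_norm ?is_norm_ge0// mulVf ?gt_eqF.
Qed.

Lemma superdifferential_compact (f : 'rV[R]_m -> R) z :
  compact (superdifferential f z).
Proof.
apply: bounded_closed_compact.
  pose up (j : 'I_m) := f z - f (z - delta_mx 0 j).
  pose lo (j : 'I_m) := f z - f (z + delta_mx 0 j).
  apply: (@normr_bounded_set _ _ _ (\sum_(j < m) (`|lo j| + `|up j|))) => xi xif.
  apply: normr_le_coord; first by apply: sumr_ge0 => j _; rewrite addr_ge0.
  move=> j; apply: (@le_trans _ _ (`|lo j| + `|up j|)); last first.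
    by rewrite (bigD1 j)//= lerDl; apply: sumr_ge0 => l _; exact: addr_ge0.
  have := xif (z + delta_mx 0 j); have := xif (z - delta_mx 0 j).
  rewrite ![_ - z]addrC !addKr dotNr dot_delta => H1 H2.
  have := ler_norm (up j); have := ler_norm (lo j).
  have := normr_ge0 (up j); have := normr_ge0 (lo j).
  by rewrite ler_norml /up /lo => *; apply/andP; split; lra.
rewrite (_ : superdifferential f z =
    \bigcap_y (dot (y - z) @^-1` [set x | f y - f z <= x])).
  apply: closed_bigI => y _; apply: preimage_closed => [v _|].
    exact: dot_continuousr.
  exact: closed_ge.
have dotC (a b : 'rV[R]_m) : dot a b = dot b a.
  by apply: eq_bigr => j _; rewrite mulrC.
apply/seteqP; split => [xi xif y _ /=|xi xif y].
  by have := xif y; rewrite dotC; lra.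
by have := xif y I; rewrite /= dotC; lra.
Qed.

Lemma supergradient_norms_has_max (f : 'rV[R]_m -> R) z :
  concave_function setT f -> has_max (supergradient_norms nrm f z).
Proof.
move=> cf.
have cDB := compact_setX (@superdifferential_compact f z) is_norm_ball_compact.
have [xi0 xi0f] := superdifferential_nonempty z cf.
have DB0 : superdifferential f z `*` [set v | nrm v <= 1] !=set0.
  by exists (xi0, 0); split => //=; rewrite is_norm0.
have [[xi v] /set_mem[/= xif v1] vmax] := compact_EVT_max DB0 cDB
  (continuous_subspaceT dot_continuous).
have {}vmax eta w : superdifferential f z eta -> nrm w <= 1 ->
    dot eta w <= dot xi v.
  by move=> etaf w1; apply: (vmax (eta, w)); rewrite inE.
exists (dual_norm nrm xi); split; first by exists xi.
move=> _ [eta etaf <-].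
have [w w1 [-> _]] := dual_norm_attained eta.
have [u u1 [-> umax]] := dual_norm_attained xi.
exact: le_trans (vmax _ _ etaf w1) (umax _ v1).
Qed.

End norm_facts.

Lemma has_max_maxval {R : realType} (S : set R) :
  has_max S -> is_max S (maxval S).
Proof. by move=> S_max; exact: (xgetPex 0). Qed.

Lemma has_max_finite {R : realType} {I : finType} (i0 : I) (F : I -> R) :
  has_max [set F i | i in setT].
Proof.
have [i _ Fi] := @arg_maxP _ R I i0 xpredT F isT.
by exists (F i); split; [exists i|move=> _ [j _ <-]; exact: Fi].
Qed.

Lemma dot_shift_continuous {R : realType} {m : nat} (xi z : 'rV[R]_m) :
  continuous (fun y : 'rV[R]_m => dot xi (y - z)).
Proof.
move=> y; apply: (@continuous_comp _ _ _ (fun y : 'rV[R]_m => y - z) (dot xi)).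
  have FF := nbhs_filter y; apply: cvgB; [exact: cvg_id|exact: cvg_cst].
exact: dot_continuousr.
Qed.

(* The hypograph, an intersection of closed half-spaces, is closed; one maximizes
   the height over a compact slice of it. *)
Lemma concave_compact_max {R : realType} {m : nat} (f : 'rV[R]_m -> R)
    (A : set 'rV[R]_m) :
  concave_function setT f -> compact A -> A !=set0 ->
  exists2 z, A z & forall y, A y -> f y <= f z.
Proof.
move=> cf cA A0; have [z0 Az0] := A0.
have [xi0 xi0f] := superdifferential_nonempty z0 cf.
have [y1 _ y1max] := EVT_max_rV A0 cA
  (continuous_subspaceT (@dot_shift_continuous _ _ xi0 z0)).
pose M := f z0 + dot xi0 (y1 - z0).
have fM y : A y -> f y <= M.
  move=> Ay; apply: le_trans (xi0f y) _; rewrite lerD2l.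
  by apply: y1max; rewrite inE.
pose H := (A `*` `[f z0, M]%classic) `&`
  \bigcap_(zx in [set zx : 'rV[R]_m * 'rV[R]_m | superdifferential f zx.1 zx.2])
    [set w : 'rV[R]_m * R | w.2 <= f zx.1 + dot zx.2 (w.1 - zx.1)].
have HP y t : H (y, t) <-> [/\ A y, f z0 <= t & t <= f y].
  split => [[[/= Ay]]|[Ay zt ty]].
    rewrite in_itv/= => /andP[zt _] Hyt; split => //.
    have [xi xif] := superdifferential_nonempty y cf.
    by have := Hyt (y, xi) xif; rewrite /= subrr dot0r addr0.
  split; first by split => //=; rewrite in_itv/= zt (le_trans ty) ?fM.
  by move=> [z xi] /= xif; exact: le_trans ty (xif y).
have cH : compact H.
  apply: compact_closedI.
    exact: (compact_setX cA (@segment_compact _ _ _)).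
  apply: closed_bigI => -[z xi] /= _.
  rewrite (_ : [set _ | _] =
      (fun w : 'rV[R]_m * R => w.2 - dot xi (w.1 - z)) @^-1`
      [set t | t <= f z]); last first.
    by apply/seteqP; split => -[y t] /=; lra.
  apply: preimage_closed => [w _|]; last exact: closed_le.
  apply: cvgB; first exact: cvg_snd.
  apply: (@continuous_comp _ _ _ fst (fun y : 'rV[R]_m => dot xi (y - z))).
    exact: cvg_fst.
  exact: dot_shift_continuous.
have H0 : H !=set0 by exists (z0, f z0); apply/HP.
have [[z t] /set_mem/HP[Az z0t tz] zmax] := compact_EVT_max H0 cH
  (continuous_subspaceT (fun w : 'rV[R]_m * R => @cvg_snd _ _ _ _ _)).
exists z => // y Ay; apply: le_trans _ tz.
have [yz0|/ltW z0y] := leP (f y) (f z0); first exact: le_trans z0t.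
by have := zmax (y, f y); rewrite inE; apply; apply/HP.
Qed.

Lemma powR_root_le {R : realType} (a u p : R) :
  1 <= p -> 0 <= a -> a `^ p <= u -> a <= u `^ p^-1.
Proof.
move=> p1 a0 au; have p0 : 0 < p by lra.
have u0 : 0 <= u by exact: le_trans (powR_ge0 _ _) au.
have -> : a = (a `^ p) `^ p^-1 by rewrite -powRrM mulfV ?gt_eqF// powRr1.
by apply: ge0_ler_powR; rewrite ?nnegrE ?powR_ge0// invr_ge0 ltW.
Qed.

Section cost_sublevel.
Context {R : realType} {m : nat} (Z : set 'rV[R]_m).
Variables (c : 'rV[R]_m -> 'rV[R]_m -> R) (nrm : 'rV[R]_m -> R) (p : R).
Hypotheses (hc : transport_cost Z c) (Zclosed : closed Z) (hn : is_norm nrm).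
Hypotheses (p1 : 1 <= p).
Hypothesis (growth : forall z zh, Z z -> Z zh -> nrm (z - zh) `^ p <= c z zh).

Lemma cost_sublevel_closed zh u : Z zh -> closed [set z | Z z /\ c z zh <= u].
Proof.
move=> Zzh z clz.
have Zz : Z z by apply: Zclosed; apply: closure_subset clz => y [].
split => //; rewrite leNgt; apply/negP => uc.
have [V] := @cost_lsc _ _ _ _ hc (z, zh) u uc.
move=> zV Vc.
have {}zV : within (Z `*` Z) (nbhs (z, zh)) V by rewrite nbhs_subspace_in.
have near_z : \forall y \near z, (Z `*` Z) (y, zh) -> V (y, zh).
  have FF := nbhs_filter z.
  exact: (cvg_pair (@cvg_id _ (nbhs z)) (@cvg_cst _ zh _ (nbhs z) FF)) _ zV.
have [y [[Zy cy] Vy]] := clz _ near_z.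
by have := Vc _ (Vy (conj Zy Zzh)); rewrite lte_fin ltNge cy.
Qed.

Lemma cost_sublevel_compact zh u : Z zh -> compact [set z | Z z /\ c z zh <= u].
Proof.
move=> Zzh; apply: bounded_closed_compact; last exact: cost_sublevel_closed.
have [C C0 nC] := normr_le_is_norm hn.
apply: (@normr_bounded_set _ _ _ (C * u `^ p^-1 + `|zh|)) => z [Zz zu].
rewrite -{1}(subrK zh z); apply: le_trans (ler_normD _ _) _; rewrite lerD2r.
apply: le_trans (nC _) _; rewrite ler_pM2l//.
by apply: powR_root_le; rewrite ?is_norm_ge0// (le_trans (growth _ _)).
Qed.

Lemma weighted_ball_has_max (f : 'rV[R]_m -> R) zh a u :
  concave_function setT f -> Z zh -> 0 <= a -> 0 <= u ->
  exists2 v, Z (zh + v) /\ a * c (zh + v) zh <= u &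
    forall w, Z (zh + w) -> a * c (zh + w) zh <= u ->
      a * f (zh + w) <= a * f (zh + v).
Proof.
move=> cf Zzh a0 u0; have [->|an0] := eqVneq a 0.
  by exists 0 => [|w _ _]; rewrite ?addr0 ?mul0r.
have {}a0 : 0 < a by rewrite lt_neqAle eq_sym an0.
have [|z [Zz zu] zmax] :=
  concave_compact_max cf (@cost_sublevel_compact zh (u / a) Zzh).
  by exists zh; split; rewrite ?(cost_refl hc)// divr_ge0// ltW.
exists (z - zh); rewrite [zh + _]addrC subrK.
  by split => //; rewrite mulrC -ler_pdivlMr.
move=> w Zw wu; rewrite ler_pM2l//; apply: zmax.
by split; rewrite // ler_pdivlMr// mulrC.
Qed.

End cost_sublevel.

Lemma Psi_has_max {R : realType} {m : nat} (Z : set 'rV[R]_m) c nrm (p : R)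
    (f1 f2 : 'rV[R]_m -> R) zh alpha beta :
  transport_cost Z c -> closed Z -> is_norm nrm -> 1 <= p ->
  (forall z zh, Z z -> Z zh -> nrm (z - zh) `^ p <= c z zh) ->
  concave_function setT f1 -> concave_function setT f2 -> Z zh ->
  0 <= alpha.1 -> 0 <= alpha.2 -> 0 <= beta.1 -> 0 <= beta.2 ->
  has_max (Psi_values Z c f1 f2 zh alpha beta).
Proof.
move=> hc Zcl hn p1 growth cf1 cf2 Zzh a1 a2 b1 b2.
have [v1 [Zv1 cv1] v1max] :=
  weighted_ball_has_max hc Zcl hn p1 growth cf1 Zzh a1 b1.
have [v2 [Zv2 cv2] v2max] :=
  weighted_ball_has_max hc Zcl hn p1 growth cf2 Zzh a2 b2.
exists (alpha.1 * f1 (zh + v1) + alpha.2 * f2 (zh + v2)).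
split; first by exists v1, v2.
move=> _ [w1 [w2 [Zw1 Zw2 cw1 cw2 ->]]].
by apply: lerD; [exact: v1max|exact: v2max].
Qed.

Section budget_transfer.
Context {R : realType} {m : nat} (Z : set 'rV[R]_m).
Variables (c : 'rV[R]_m -> 'rV[R]_m -> R) (nrm : 'rV[R]_m -> R) (p : R).
Hypotheses (hc : transport_cost Z c) (Zconvex : convex_set Z) (hn : is_norm nrm).
Hypotheses (p1 : 1 <= p).
Hypothesis (growth : forall z zh, Z z -> Z zh -> nrm (z - zh) `^ p <= c z zh).

Lemma budget_transfer (f : 'rV[R]_m -> R) (G : R) zh a u u' v :
  concave_function setT f -> Z zh -> 0 <= G ->
  (forall w, f (zh + w) - f zh <= G * nrm w) ->
  0 <= a <= 1 -> 0 <= u -> 0 <= u' -> Z (zh + v) -> a * c (zh + v) zh <= u' ->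
  exists w, [/\ Z (zh + w), a * c (zh + w) zh <= u &
    a * f (zh + v) - G * `|u - u'| `^ p^-1 <= a * f (zh + w)].
Proof.
move=> cf Zzh G0 fG /andP[a0 a1] u0 u'0 Zv cv.
have p0 : 0 < p by exact: lt_le_trans ltr01 p1.
have penalty0 : 0 <= G * `|u - u'| `^ p^-1 by rewrite mulr_ge0// powR_ge0.
have [u'u|uu'] := leP u' u.
  by exists v; split => //; [exact: le_trans u'u|lra].
have [az|an0] := eqVneq a 0.
  by exists v; split => //; rewrite az !mul0r; lra.
have {an0}a0' : 0 < a by rewrite lt_neqAle eq_sym an0.
have u'pos : 0 < u' by lra.
pose t := u / u'; have tu' : t * u' = u by rewrite /t divfK// gt_eqF.
have t01 : 0 <= t <= 1.
  by rewrite divr_ge0//= ler_pdivrMr// mul1r ltW.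
have /andP[t0 t1] := t01.
have shrink : zh + t *: v = t *: (zh + v) + (1 - t) *: zh.
  by rewrite scalerDr addrAC -scalerDl [t + _]addrC subrK scale1r.
exists (t *: v); split.
- by rewrite shrink; exact: convex_setE.
- have := convex_functionE (cost_convex hc Zzh) t01 Zv Zzh.
  rewrite -shrink /= (cost_refl hc)// mulr0 addr0 => /(ler_wpM2l a0) H.
  apply: le_trans H _; rewrite mulrCA -tu'; exact: ler_wpM2l.
have := concave_functionE cf t01 (I : setT (zh + v)) (I : setT zh).
rewrite -shrink => /(ler_wpM2l a0) H.
suff : (1 - t) * a * (f (zh + v) - f zh) <= G * `|u - u'| `^ p^-1 by lra.
have s0 : 0 < 1 - t by rewrite subr_gt0 /t ltr_pdivrMr// mul1r.
have vb : nrm v <= (u' / a) `^ p^-1.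
  apply: powR_root_le; rewrite ?is_norm_ge0//.
  have := growth Zv Zzh; rewrite addrAC subrr add0r => /le_trans; apply.
  by rewrite ler_pdivlMr// mulrC.
have root s : 0 < s <= 1 -> s <= s `^ p^-1.
  by move=> s01; apply: ger1_powR => //; rewrite invf_le1.
apply: (@le_trans _ _ ((1 - t) * a * (G * nrm v))).
  by apply: ler_wpM2l; [rewrite mulr_ge0// ltW|exact: fG].
rewrite mulrCA; apply: ler_wpM2l => //.
rewrite distrC ger0_norm; last by lra.
have -> : u' - u = (1 - t) * a * (u' / a).
  by rewrite -tu'; field; rewrite gt_eqF.
have sa0 : 0 <= (1 - t) * a by rewrite mulr_ge0// ltW.
rewrite powRM ?divr_ge0//; apply: ler_pM => //; first exact: is_norm_ge0.
by apply: root; rewrite mulr_gt0//= mulr_ile1 ?gerBl// ltW.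
Qed.

End budget_transfer.

(* The first three conjuncts of the conclusion say that the maxima defining
   Psi and G_i are attained, so that no junk value is involved. *)
Theorem lemma9 (R : realType) (n m K N : nat)
  (X : set 'rV[R]_n) (Z : set 'rV[R]_m)
  (c : 'rV[R]_m -> 'rV[R]_m -> R) (hc : transport_cost Z c)
  (zhat : 'I_N -> 'rV[R]_m) (hzhat : forall i, Z (zhat i))
  (rho : R) (hrho : 0 < rho)
  (ellk : 'I_K -> 'rV[R]_n -> 'rV[R]_m -> R)
  (nrm : 'rV[R]_m -> R) (p : R)
  (hreg : regularity X Z c zhat rho ellk nrm p)
  (x : 'rV[R]_n) (hx : X x)
  (horacle : local_oracle Z c (fun k => ellk k x))
  (i : 'I_N) (k1 k2 : 'I_K) (hk : (k1 < k2)%N)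
  (b : R) (hb : 0 <= b)
  (alpha : R * R) (halpha1 : 0 <= alpha.1) (halpha2 : 0 <= alpha.2)
  (halpha : alpha.1 + alpha.2 = 1)
  (beta beta' : R * R)
  (hbeta1 : 0 <= beta.1) (hbeta2 : 0 <= beta.2)
  (hbeta : beta.1 + beta.2 = b)
  (hbeta'1 : 0 <= beta'.1) (hbeta'2 : 0 <= beta'.2)
  (hbeta' : beta'.1 + beta'.2 = b) :
  [/\ has_max (Psi_values Z c (ellk k1 x) (ellk k2 x) (zhat i) alpha beta),
      has_max (Psi_values Z c (ellk k1 x) (ellk k2 x) (zhat i) alpha beta'),
      forall k : 'I_K, has_max (supergradient_norms nrm (ellk k x) (zhat i))
    & `|Psi Z c (ellk k1 x) (ellk k2 x) (zhat i) alpha beta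
        - Psi Z c (ellk k1 x) (ellk k2 x) (zhat i) alpha beta'|
      <= 2 * max_supergradient_norm nrm (fun k => ellk k x) (zhat i)
         * `|beta.1 - beta'.1| `^ p^-1].
Proof.
have hn := reg_norm hreg; have p1 := reg_p hreg.
have cf k := reg_concave hreg k x.
have growth := reg_cost_growth hreg.
have Zi := hzhat i.
have max_Psi g : 0 <= g.1 -> 0 <= g.2 ->
    has_max (Psi_values Z c (ellk k1 x) (ellk k2 x) (zhat i) alpha g).
  move=> g1 g2.
  exact: Psi_has_max hc (reg_Z_closed hreg) hn p1 growth _ _ _ _ _ _ _.
have max_norms k := supergradient_norms_has_max hn (zhat i) (cf k).
split; [exact: max_Psi|exact: max_Psi|exact: max_norms|].
set G := max_supergradient_norm _ _ _; set d := `|beta.1 - beta'.1| `^ p^-1.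
have normG k xi : superdifferential (ellk k x) (zhat i) xi ->
    dual_norm nrm xi <= G.
  move=> xik; apply: (@le_trans _ _
    (maxval (supergradient_norms nrm (ellk k x) (zhat i)))).
    by apply: (has_max_maxval (max_norms k)).2; exists xi.
  by apply: (has_max_maxval (has_max_finite k1 _)).2; exists k.
have fG k w : ellk k x (zhat i + w) - ellk k x (zhat i) <= G * nrm w.
  have [xi xik] := superdifferential_nonempty (zhat i) (cf k).
  have := xik (zhat i + w); rewrite addrAC subrr add0r -lerBlDl => /le_trans; apply.
  apply: le_trans (dot_le_dual_norm hn xi w) _.
  by apply: ler_wpM2r; [exact: is_norm_ge0|exact: normG xik].
have G0 : 0 <= G.
  have [xi xik] := superdifferential_nonempty (zhat i) (cf k1).
  exact: le_trans (dual_norm_ge0 hn xi) (normG _ _ xik).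
have transfer g g' : 0 <= g.1 -> 0 <= g.2 -> 0 <= g'.1 -> 0 <= g'.2 ->
    g.1 + g.2 = g'.1 + g'.2 ->
    Psi Z c (ellk k1 x) (ellk k2 x) (zhat i) alpha g'
    - Psi Z c (ellk k1 x) (ellk k2 x) (zhat i) alpha g
    <= 2 * G * `|g.1 - g'.1| `^ p^-1.
  move=> g1 g2 g'1 g'2 gg'.
  have [[v1 [v2 [Zv1 Zv2 cv1 cv2 PsiE]]] _] := has_max_maxval (max_Psi _ g'1 g'2).
  have a1 : 0 <= alpha.1 <= 1 by apply/andP; split; lra.
  have a2 : 0 <= alpha.2 <= 1 by apply/andP; split; lra.
  have [w1 [Zw1 cw1 fw1]] := budget_transfer hc (reg_Z_convex hreg) hn p1
    growth (cf k1) Zi G0 (fG k1) a1 g1 g'1 Zv1 cv1.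
  have [w2 [Zw2 cw2 fw2]] := budget_transfer hc (reg_Z_convex hreg) hn p1
    growth (cf k2) Zi G0 (fG k2) a2 g2 g'2 Zv2 cv2.
  have := (has_max_maxval (max_Psi _ g1 g2)).2
    (alpha.1 * ellk k1 x (zhat i + w1) + alpha.2 * ellk k2 x (zhat i + w2)).
  move=> /(_ (ex_intro _ w1 (ex_intro _ w2 (And5 Zw1 Zw2 cw1 cw2 erefl)))).
  rewrite /Psi PsiE.
  have gE : `|g.2 - g'.2| = `|g.1 - g'.1|.
    by rewrite -normrN; congr `|_|; lra.
  by rewrite gE in fw2; lra.
rewrite ler_norml; apply/andP; split.
  by rewrite lerNl opprB /d; apply: transfer => //; rewrite hbeta hbeta'.
by rewrite /d distrC; apply: transfer => //; rewrite hbeta hbeta'.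
Qed.
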